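(* Let $S$ be a finite set of positive integers that is $n$-admissible for some $n$. If $S=\emptyset$ let $m=1$; otherwise let $m=\max(S)$. Then there is a polynomial $p_\delta$ in one variable, of degree $m-1$ and taking integer values at all integers, such that \[ |\underline{P(S;n)}| = p_\delta(n) \] for every integer $n\ge 2$ such that $S\subset[n-1]$ and $S$ is $n$-admissible.
   Context: Notation: $[n]=\{1,\dots,n\}$. $\mathfrak{S}_n$ is the symmetric group on $[n]$, with permutations written in one-line notation $\pi=\pi_1\pi_2\cdots\pi_n$. An index $i$ with $2\le i\le n-1$ is a peak of $\pi$ if $\pi_{i-1}<\pi_i>\pi_{i+1}$; $P(\pi)$ is the set of peaks of $\pi$, and $P(S;n)=\{\pi\in\mathfrak{S}_n\mid P(\pi)=S\}$. A set $S\subset[n]$ is $n$-admissible if $P(S;n)\ne\emptyset$. For $1\le k\le n$, $P(S;n)_{\searrow k}=\{\pi\in P(S;n)\mid \pi_{n-1}>\pi_n\text{ and }\pi_n=k\}$, and $\underline{P(S;n)}=\bigsqcup_{k=1}^n P(S;n)_{\searrow k}$ (the elements of $P(S;n)$ that end with a descent). *)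

(* Defs.v *)
From mathcomp Require Import all_boot all_order all_fingroup all_algebra.
From mathcomp Require Import finmap.

Set Implicit Arguments.
Unset Strict Implicit.
Unset Printing Implicit Defensive.

(* Permutations of [n] = {1, ..., n} are encoded as permutations of
   'I_n = {0, ..., n-1}; [entry w i] is the i-th letter of the one-line
   notation, with positions and letters both shifted back to 1, ..., n.
   Its value is irrelevant for i outside 1, ..., n. *)
Definition entry n (w : 'S_n) (i : nat) : nat :=
  nth 0 [seq (w j).+1 | j <- enum 'I_n] i.-1.

(* [iota 2 (n - 2)] lists 2, ..., n - 1. *)
Definition peaks n (w : 'S_n) : {fset nat} :=
  [fset i in iota 2 (n - 2) |
    (entry w i.-1 < entry w i) && (entry w i.+1 < entry w i)]%fset.

Definition peak_class (S : {fset nat}) (n : nat) : {set 'S_n} :=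
  [set w : 'S_n | peaks w == S].

Definition sub_interval (S : {fset nat}) (n : nat) : Prop :=
  forall i : nat, i \in S -> 1 <= i <= n.

Definition admissible (S : {fset nat}) (n : nat) : Prop :=
  sub_interval S n /\ peak_class S n != set0.

Definition peak_class_desc_to (S : {fset nat}) (n k : nat) : {set 'S_n} :=
  [set w in peak_class S n |
    (entry w n < entry w n.-1) && (entry w n == k)].

(* The union is disjoint, since k is determined by the last letter. *)
Definition peak_class_desc (S : {fset nat}) (n : nat) : {set 'S_n} :=
  (\bigcup_(1 <= k < n.+1) peak_class_desc_to S n k)%SET.

Definition max_or_one (S : {fset nat}) : nat :=
  if S == fset0 then 1 else \max_(i <- S) i.

(* Main.v *)
(* Let m be the maximum of S (m = 1 if S is empty) and k = m - 1. A permutation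
   of [n] has peak set S and ends with a descent iff it decreases from position
   m on, its first k letters have peak set S \ {m}, and, when k > 0, its k-th
   letter is smaller than its m-th one. A permutation that decreases from
   position m on amounts to the pattern t in S_k of its first k letters together
   with their set A of values, and its k-th letter exceeds the m-th one iff A
   contains the k + 1 - t_k largest elements of [n]. Hence the number to compute
   is the sum, over the t in S_k with peak set S \ {m}, of
     C(n, k) - C(n - (k + 1 - t_k), t_k - 1)
   (the subtracted term being absent for k = 0). Since t_k - 1 < k, this is a
   polynomial in n of degree k; some t occurs because S is admissible. *)
Require Import Defs.
From mathcomp Require Import all_boot all_order all_fingroup all_algebra.
From mathcomp Require Import finmap.
From mathcomp Require Import zify ring.
Set Implicit Arguments.
Unset Strict Implicit.
Unset Printing Implicit Defensive.
Import GRing.Theory Num.Theory.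

(* Positions count from 0 here: these are the positions k.+1, ..., n of [entry]. *)
Definition decreasing_from n (k : nat) (w : 'S_n) : bool :=
  [forall i : 'I_n, forall j : 'I_n, (k <= i < j) ==> (w j < w i)].

Lemma decreasing_fromP n k (w : 'S_n) :
  reflect (forall i j : 'I_n, k <= i -> i < j -> w j < w i) (decreasing_from k w).
Proof.
apply: (iffP forallP) => dec i; last first.
  by apply/forallP => j; apply/implyP => /andP[]; exact: dec.
by move=> j ki ij; apply: (implyP (forallP (dec i) j)); rewrite ki.
Qed.

Lemma entry_ord n (w : 'S_n) (i : 'I_n) : entry w i.+1 = (w i).+1.
Proof.
by rewrite /entry /= (nth_map i) ?size_enum_ord // nth_ord_enum.
Qed.

Lemma card_ord_ge n c : #|[set x : 'I_n | c <= x]| = n - c.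
Proof.
rewrite -sum1_card.
under eq_bigl do rewrite inE -[c <= _]/(true && (c <= _)).
by rewrite -(big_geq_mkord c n xpredT (fun=> 1)) sum_nat_const_nat muln1.
Qed.

Lemma card_ord_lt n c : c <= n -> #|[set x : 'I_n | x < c]| = c.
Proof.
move=> le_cn; have := cardsC [set x : 'I_n | c <= x].
rewrite card_ord_ge card_ord.
have -> : ~: [set x : 'I_n | c <= x] = [set x : 'I_n | x < c].
  by apply/setP=> x; rewrite !inE -ltnNge.
lia.
Qed.

(** * Increasing enumeration of a set of ordinals *)

Section EnumOrd.
Variable n : nat.
Implicit Type A : {set 'I_n.+1}.

Lemma sorted_enum_ord A : sorted ltn (map val (enum A)).
Proof.
apply: (subseq_sorted ltn_trans (s2 := map val (enum 'I_n.+1))).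
  by apply: map_subseq; rewrite enumT; exact: filter_subseq.
by rewrite val_enum_ord iota_ltn_sorted.
Qed.

Lemma ltn_nth_enum A i j : i < #|A| -> j < #|A| ->
  (nth ord0 (enum A) i < nth ord0 (enum A) j) = (i < j).
Proof.
move=> lti ltj.
have := sorted_enum_ord A; set s := map _ _ => s_sort.
have E a : a < #|A| -> val (nth ord0 (enum A) a) = nth 0 s a.
  by move=> lta; rewrite (nth_map ord0) // -cardE.
rewrite -/(val _ < val _) !E //.
have [lt_ij|le_ji] := ltnP i j.
  by rewrite (sorted_ltn_nth ltn_trans) // inE size_map -cardE.
apply/negbTE; rewrite -leqNgt; move: le_ji; rewrite leq_eqVlt => /orP[/eqP->//|lt_ji].
by apply: ltnW; rewrite -/(ltn _ _) (sorted_ltn_nth ltn_trans) // inE size_map -cardE.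
Qed.

(** Enumeration is increasing, so these elements are the images of the indices from [j] to
    [#|A| - 1]. *)
Lemma card_ge_nth_enum A j : j < #|A| ->
  #|[set x in A | nth ord0 (enum A) j <= x]| = #|A| - j.
Proof.
move=> ltj; rewrite -(card_ord_ge #|A| j).
rewrite -(card_imset _ (f := fun i : 'I_#|A| => nth ord0 (enum A) i)); last first.
  move=> i i' /eqP; rewrite nth_uniq ?enum_uniq -?cardE //; by move/eqP/val_inj.
apply: eq_card => x; rewrite !inE; apply/andP/imsetP => [[xA]|[i]].
  have ltx : index x (enum A) < #|A| by rewrite cardE index_mem mem_enum.
  rewrite leqNgt => H; exists (Ordinal ltx); last by rewrite nth_index ?mem_enum.
  rewrite inE /= leqNgt; apply: contra H => lt.
  rewrite -[in X in X < _](nth_index ord0 (_ : x \in enum A)) ?mem_enum //.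
  by rewrite ltn_nth_enum.
rewrite inE => le ->; split; first by rewrite -mem_enum mem_nth // -cardE.
by rewrite leqNgt ltn_nth_enum // -leqNgt.
Qed.

End EnumOrd.

(** * Permutations with a decreasing tail, as pairs of a head pattern and a set of head values *)

Section Shuffle.
Variables n k : nat.
Implicit Types (t : 'S_k) (A : {set 'I_n.+1}).

(** When [#|A| = k], this is the one-line notation of the permutation whose head has pattern [t] and
    set of values [A], and whose tail decreases. *)
Definition shuffle_word t A : seq 'I_n.+1 :=
  [seq nth ord0 (enum A) (t i) | i <- enum 'I_k] ++ rev (enum (~: A)).

(* Junk (the identity) when #|A| differs from k. *)
Definition shuffle t A : 'S_n.+1 :=
  insubd (1%g : 'S_n.+1) [ffun i : 'I_n.+1 => nth ord0 (shuffle_word t A) i].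

Section Fixed.
Variables (t : 'S_k) (A : {set 'I_n.+1}).
Hypothesis Ak : #|A| = k.

Lemma size_shuffle_word : size (shuffle_word t A) = n.+1.
Proof.
rewrite size_cat size_map size_rev -!cardE card_ord -[RHS]card_ord -(cardsC A).
by rewrite Ak.
Qed.

Lemma shuffle_word_uniq : uniq (shuffle_word t A).
Proof.
rewrite cat_uniq rev_uniq enum_uniq andbT; apply/andP; split.
  rewrite map_inj_uniq ?enum_uniq // => i j /eqP.
  by rewrite nth_uniq ?enum_uniq -?cardE ?Ak // => /eqP/val_inj/perm_inj.
apply/hasPn => x; rewrite mem_rev mem_enum inE; apply: contra => /mapP[i _ ->].
by rewrite -mem_enum mem_nth // -cardE Ak.
Qed.

Lemma shuffleE (i : 'I_n.+1) : shuffle t A i = nth ord0 (shuffle_word t A) i.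
Proof.
rewrite -pvalE insubdK ?ffunE //; apply/injectiveP => a b; rewrite !ffunE => /eqP.
by rewrite nth_uniq ?size_shuffle_word ?shuffle_word_uniq // => /eqP/val_inj.
Qed.

Lemma shuffle_head (i : 'I_k) (j : 'I_n.+1) : i = j :> nat ->
  shuffle t A j = nth ord0 (enum A) (t i).
Proof.
move=> ij; rewrite shuffleE nth_cat size_map size_enum_ord -ij ltn_ord.
by rewrite (nth_map i) ?size_enum_ord // nth_ord_enum.
Qed.

(** Reversal sends offset [j - k] of the tail to index [n - j] of the complement, which has
    [n + 1 - k] elements. The bound is what comparisons and membership of [nth] require. *)
Lemma shuffle_tail (j : 'I_n.+1) : k <= j ->
  shuffle t A j = nth ord0 (enum (~: A)) (n - j) /\ n - j < #|~: A|.
Proof.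
move=> kj; have sz := cardsC A; rewrite card_ord Ak in sz; have jn := ltn_ord j.
split; last lia.
rewrite shuffleE nth_cat size_map size_enum_ord ltnNge kj /= nth_rev -cardE; last first.
  by move: sz jn kj; set c := #|_|; lia.
by congr nth; move: sz jn kj; set c := #|_|; lia.
Qed.

Lemma shuffle_in (j : 'I_n.+1) : (shuffle t A j \in A) = (j < k).
Proof.
have [ltj|lej] := ltnP j k.
  by rewrite (@shuffle_head (Ordinal ltj)) // -mem_enum mem_nth // -cardE Ak.
have [-> lt] := shuffle_tail lej.
by apply/negbTE; rewrite -in_setC -mem_enum mem_nth // -cardE.
Qed.

Lemma shuffle_decreasing : decreasing_from k (shuffle t A).
Proof.
apply/decreasing_fromP => i j ki ij.
have [-> lti] := shuffle_tail ki.
have [-> ltj] := shuffle_tail (leq_trans ki (ltnW ij)).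
rewrite ltn_nth_enum //; have := ltn_ord j; lia.
Qed.

End Fixed.

(** [A] is recovered as the set of letters at positions below [k], and then [t] from the ranks of
    these letters in [A]. *)
Lemma shuffle_inj t A t' A' : #|A| = k -> #|A'| = k ->
  shuffle t A = shuffle t' A' -> (t, A) = (t', A').
Proof.
move=> Ak Ak' eqs; have eqA : A = A'.
  apply/setP=> x; rewrite -(permKV (shuffle t A) x) shuffle_in // eqs.
  by rewrite shuffle_in.
subst A'; congr pair; apply/permP=> i.
have kn : k <= n.+1 by rewrite -Ak; have := max_card A; rewrite card_ord.
have := congr1 (fun w : 'S_n.+1 => w (widen_ord kn i)) eqs.
rewrite /= !(@shuffle_head _ _ _ i) // => /eqP.
by rewrite nth_uniq ?enum_uniq -?cardE ?Ak // => /eqP/val_inj.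
Qed.

(** [A] collects the first [k] letters, and [t] sends a position to the rank of its letter in
    [A]. *)
Lemma head_pattern (w : 'S_n.+1) : k <= n.+1 ->
  exists t A, #|A| = k /\ forall (i : 'I_k) (j : 'I_n.+1), i = j :> nat ->
    w j = nth ord0 (enum A) (t i).
Proof.
move=> kn; pose A := [set w j | j in [set j : 'I_n.+1 | j < k]].
have Ak : #|A| = k by rewrite card_imset ?card_ord_lt //; exact: perm_inj.
have inA (i : 'I_k) : w (widen_ord kn i) \in enum A.
  by rewrite mem_enum imset_f // inE /=.
have lt (i : 'I_k) : index (w (widen_ord kn i)) (enum A) < k.
  by rewrite -[X in _ < X]Ak cardE index_mem.
have inj : injective (fun i => Ordinal (lt i)).
  move=> i j /(congr1 val) /= e; have := congr1 (nth ord0 (enum A)) e.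
  by rewrite !nth_index // => /perm_inj/(congr1 val) /= ij; exact: val_inj.
exists (perm inj), A; split=> // i j ij; rewrite permE /= nth_index //.
by congr (w _); apply: val_inj.
Qed.

(** The head determines which letters remain, and they have only one decreasing arrangement. The
    proof is a strong induction on the position. *)
Lemma decreasing_from_eq (w w' : 'S_n.+1) :
  decreasing_from k w -> decreasing_from k w' ->
  (forall j : 'I_n.+1, j < k -> w j = w' j) -> w = w'.
Proof.
move=> /decreasing_fromP dw /decreasing_fromP dw' eqw; apply/permP => i.
(* [v' j] is one of the letters of [v] at positions from j on, of which [v j] is the
   largest. *)
have ge (v v' : 'S_n.+1) (j : 'I_n.+1) : k <= j ->
    (forall i i' : 'I_n.+1, k <= i -> i < i' -> v i' < v i) ->
    (forall i : 'I_n.+1, i < j -> v i = v' i) -> v' j <= v j.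
  move=> kj dv eqv; rewrite -(permKV v (v' j)); set l := (v^-1)%g _.
  have vl : v l = v' j by rewrite permKV.
  have [lj|] := ltnP l j.
    by move: vl (lj); rewrite (eqv l lj) => /perm_inj ->; rewrite ltnn.
  rewrite leq_eqVlt => /orP[/eqP/val_inj<-//|jl]; exact/ltnW/dv.
have [m] := ubnP (i : nat); elim: m i => // m IH i; rewrite ltnS => im.
have [/eqw//|ki] := ltnP i k.
apply/val_inj/eqP; rewrite eqn_leq; apply/andP; split; apply: ge => //.
  by move=> j ji; rewrite IH //; exact: leq_trans ji im.
by move=> j ji; rewrite IH //; exact: leq_trans ji im.
Qed.

Lemma shuffle_surj (w : 'S_n.+1) : k <= n.+1 -> decreasing_from k w ->
  exists t A, #|A| = k /\ shuffle t A = w.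
Proof.
move=> kn dw; have [t [A [Ak tA]]] := head_pattern w kn.
exists t, A; split=> //; apply: decreasing_from_eq => //.
  exact: shuffle_decreasing.
move=> j jk; rewrite (tA (Ordinal jk)) //; exact: shuffle_head.
Qed.

Lemma card_decreasing_from (Q : pred 'S_n.+1) : k <= n.+1 ->
  #|[set w | decreasing_from k w && Q w]| =
  \sum_(t : 'S_k) #|[set A : {set 'I_n.+1} | (#|A| == k) && Q (shuffle t A)]|.
Proof.
move=> kn.
transitivity #|[set p : 'S_k * {set 'I_n.+1} | (#|p.2| == k) && Q (shuffle p.1 p.2)]|.
  rewrite -[RHS](card_in_imset (f := fun p => shuffle p.1 p.2)); last first.
    move=> [t A] [t' A']; rewrite !inE /= => /andP[/eqP Ak _] /andP[/eqP Ak' _].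
    exact: shuffle_inj.
  apply: eq_card => w; rewrite inE; apply/andP/imsetP => [[dw Qw]|].
    have [t [A [Ak tA]]] := shuffle_surj kn dw.
    by exists (t, A); rewrite // inE /= Ak eqxx tA.
  case=> [[t A]]; rewrite inE /= => /andP[/eqP Ak QA] ->; split=> //.
  exact: shuffle_decreasing.
rewrite -sum1_card.
under [RHS]eq_bigr do rewrite -sum1_card.
rewrite pair_big_dep /=; apply: eq_bigl => -[t A]; by rewrite !inE.
Qed.

(** The letter [w b] is the largest one outside [A], and exactly [k - t i] letters of [A] are at
    least [w a]. So [w a] exceeds [w b] iff every letter from [w a] up is in [A], that is, iff [A]
    contains the [k - t i] largest letters. Values of [t] start at 0 here, whence no [+ 1]. *)
Lemma shuffle_ascent t A (i : 'I_k) (a b : 'I_n.+1) :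
    #|A| = k -> i.+1 = k -> i = a :> nat -> b = k :> nat ->
  (shuffle t A a < shuffle t A b) =
  ~~ ([set x : 'I_n.+1 | n.+1 - (k - t i) <= x] \subset A).
Proof.
move=> Ak ik ia bk; set w := shuffle t A; set s := k - t i.
have wa : w a = nth ord0 (enum A) (t i) by exact: shuffle_head.
have up : #|[set x in A | w a <= x]| = s.
  by rewrite wa card_ge_nth_enum ?Ak.
have waA : w a \in A by rewrite shuffle_in //; lia.
have wbA : w b \notin A by rewrite shuffle_in //; lia.
have sn : s <= n.+1 by rewrite -up -[X in _ <= X](card_ord n.+1) max_card.
have wb x : x \notin A -> x <= w b.
  rewrite -(permKV w x); set j := (w^-1)%g x; rewrite shuffle_in // -leqNgt => kj.
  have [jb|bj] := leqP j b; first by rewrite (_ : j = b) //; apply: val_inj => /=; lia.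
  by apply/ltnW/(decreasing_fromP k w _) => //; [exact: shuffle_decreasing | lia].
have [ab|ba] := ltnP (w a) (w b).
  apply/esym; apply/negP => sub.
  have lt : w b < n.+1 - s.
    by rewrite ltnNge; apply: contra wbA => le; apply: (subsetP sub); rewrite inE.
  (* Since [w a < w b < n.+1 - s], this set has [s + 1] elements, yet all are letters of [A] that
     are at least [w a]. *)
  have : #|w a |: [set x : 'I_n.+1 | n.+1 - s <= x]| <= s.
    rewrite -[X in _ <= X]up; apply/subset_leq_card/subsetP => x.
    rewrite !inE => /orP[/eqP->|le]; first by rewrite waA leqnn.
    by rewrite (subsetP sub) ?inE //=; lia.
  rewrite cardsU1 inE card_ord_ge; lia.
apply/esym/negbTE; rewrite negbK; apply/subsetP => x; rewrite inE => le.
apply: contraT => xA.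
(* A letter [y] outside [A] with [w a <= y] would give [w a <= y <= w b <= w a], but [w a] is in [A]
   and [w b] is not. *)
have : [set x in A | w a <= x] = [set x : 'I_n.+1 | w a <= x].
  apply/setP => y; rewrite !inE andb_idl // => ay; apply: contraT => yA.
  have := wb _ yA => yb; have /val_inj e : w a = w b :> nat by lia.
  by rewrite -e waA in wbA.
(* The count now forces [w a = n.+1 - s], so [w a <= x <= w b <= w a]. *)
move=> e; rewrite e card_ord_ge in up.
have := wb _ xA => xb; have := ltn_ord (w a) => wan.
have /val_inj e' : w a = w b :> nat by lia.
by rewrite -e' waA in wbA.
Qed.

End Shuffle.

(** Removing the [c] largest elements leaves an arbitrary subset of size [k - c] of the other
    [n - c]. *)
Lemma card_superset n c k : c <= k -> k <= n ->
  #|[set A : {set 'I_n} | (#|A| == k) && ([set x : 'I_n | n - c <= x] \subset A)]|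
  = 'C(n - c, k - c).
Proof.
move=> ck kn; set T := [set x : 'I_n | _].
have cT : #|T| = c by rewrite /T card_ord_ge; lia.
have cT' : #|~: T| = n - c by have := cardsC T; rewrite card_ord; lia.
rewrite -cT' -cards_draws -(card_in_imset (f := fun B => T :|: B)); last first.
  move=> B B'; rewrite !inE => /andP[BT _] /andP[BT' _] e.
  have dis (C : {set 'I_n}) : C \subset ~: T -> C = (T :|: C) :\: T.
    by move=> CT; rewrite setDUl setDv set0U; apply/esym/setDidPl; rewrite disjoints_subset.
  by rewrite (dis B) // (dis B') // e.
apply: eq_card => A; rewrite inE; apply/andP/imsetP => [[/eqP Ak TA]|[B]].
  exists (A :\: T); last by rewrite setDE setUIr setUCr setIT; apply/esym/setUidPr.
  by rewrite inE setDE subsetIr /= -setDE cardsD (setIidPr TA) Ak cT.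
rewrite inE => /andP[BT /eqP Bk] ->; split; last exact: subsetUl.
rewrite cardsU Bk cT (_ : T :&: B = set0) ?cards0; first by apply/eqP; lia.
by apply/eqP; rewrite setI_eq0 disjoint_sym disjoints_subset.
Qed.

(** * Peaks, descents and decreasing tails *)

Section Peaks.
Variable n : nat.
Implicit Types (w : 'S_n) (i j : nat).

Lemma in_peaks w i : (i \in peaks w) =
  [&& 1 < i, i < n, entry w i.-1 < entry w i & entry w i.+1 < entry w i].
Proof.
rewrite /peaks !inE /= mem_iota.
case: leqP => //= i2; rewrite (_ : (i < _) = (i < n)) //; lia.
Qed.

Lemma entry_inj w i j : 0 < i <= n -> 0 < j <= n -> entry w i = entry w j -> i = j.
Proof.
case: i j => [|i] [|j] //= li lj.
rewrite (entry_ord w (Ordinal li)) (entry_ord w (Ordinal lj)) => -[].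
by move/val_inj/perm_inj => -[->].
Qed.

Lemma entry_pred_lt w i : 0 < i <= n -> (entry w i).-1 < n.
Proof. by case: i => //= i lin; rewrite (entry_ord w (Ordinal lin)) /=. Qed.

Lemma decreasing_from_entry k w :
  reflect (forall i, k < i < n -> entry w i.+1 < entry w i) (decreasing_from k w).
Proof.
apply: (iffP (decreasing_fromP k w)) => [dec [//|i] /andP[ki lin]|dec i j ki ij].
  rewrite (entry_ord w (Ordinal lin)) (entry_ord w (Ordinal (ltnW lin))) ltnS.
  exact: dec.
have : entry w j.+1 < entry w i.+1; last by rewrite !entry_ord.
have: j < n by [].
case: j ij => j /= _; elim: j => [//|j IH]; rewrite ltnS leq_eqVlt => /orP[/eqP <-|ij] jn.
  by apply: dec; lia.
by apply: ltn_trans (IH ij (ltnW jn)); apply: dec; lia.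
Qed.

(** The final descent propagates leftwards: an ascent into a position [i > k.+1] that is followed by
    a descent would make [i] a peak. *)
Lemma peaks_descent_decreasing w k : k.+1 < n -> (forall i, i \in peaks w -> i <= k.+1) ->
  (0 < k -> k.+1 \in peaks w) -> entry w n < entry w n.-1 -> decreasing_from k w.
Proof.
move=> kn lek pk last_desc; apply/decreasing_from_entry.
have down d : d <= n - k.+2 -> entry w (n - d) < entry w (n - d).-1.
  elim: d => [|d IH] led; first by rewrite subn0.
  have := IH (ltnW led); rewrite (_ : (n - d).-1 = n - d.+1); last lia.
  rewrite (_ : n - d = (n - d.+1).+1); last lia.
  set i := n - d.+1 => desc.
  have ik : k.+1 < i by rewrite /i; lia.
  have lin : i < n by rewrite /i; lia.
  have [//|asc|eqe] := ltngtP (entry w i) (entry w i.-1).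
    have : i \in peaks w by rewrite in_peaks asc desc lin; lia.
    by move/lek; rewrite leqNgt ik.
  have := entry_inj _ _ eqe; lia.
move=> i /andP[ki lin]; move: (down (n - i.+1)).
rewrite subKn //=; apply; lia.
Qed.

Lemma peaks_decreasing w k i : decreasing_from k w -> i \in peaks w -> i <= k.+1.
Proof.
move=> /decreasing_from_entry dec; rewrite in_peaks => /and4P[i1 lin asc _].
rewrite leqNgt; apply/negP => ki.
have := dec i.-1; rewrite prednK; last lia.
by move=> H; have := ltn_trans asc (H _); rewrite ltnn => E; apply: notF; apply: E; lia.
Qed.

End Peaks.

(** Peaks depend only on comparisons of letters, which the increasing enumeration of [A] preserves;
    a peak of [t] needs a right neighbour, hence [i < k]. *)
Lemma peaks_head n k (w : 'S_n.+1) (t : 'S_k) (A : {set 'I_n.+1}) i :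
    k <= n.+1 -> #|A| = k ->
    (forall (i : 'I_k) (j : 'I_n.+1), i = j :> nat -> w j = nth ord0 (enum A) (t i)) ->
  (i \in peaks t) = (i < k) && (i \in peaks w).
Proof.
move=> kn Ak wt.
have cmp a b : 0 < a <= k -> 0 < b <= k ->
    (entry t a < entry t b) = (entry w a < entry w b).
  case: a b => [|a] [|b] //= la lb.
  rewrite (entry_ord t (Ordinal la)) (entry_ord t (Ordinal lb)).
  rewrite (entry_ord w (Ordinal (leq_trans la kn))) (entry_ord w (Ordinal (leq_trans lb kn))).
  rewrite !ltnS (wt (Ordinal la)) // (wt (Ordinal lb)) //.
  by rewrite ltn_nth_enum // Ak.
rewrite !in_peaks; case: (ltnP i k) => ik; last by rewrite andbF.
case: (ltnP 1 i) => //= i1; rewrite (leq_trans ik kn) /=.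
by congr andb; apply: cmp; lia.
Qed.

Lemma peak_class_descE n (S : {fset nat}) :
  peak_class_desc S n.+1 =
  [set w | (peaks w == S) && (entry w n.+1 < entry w n)].
Proof.
apply/setP => w; rewrite /peak_class_desc big_geq_mkord inE.
apply/bigcupP/andP => [[k _]|[pw desc]].
  by rewrite !inE => /and3P[].
have e : entry w n.+1 < n.+2 by rewrite (entry_ord w ord_max) ltnS.
exists (Ordinal e); first by rewrite /= (entry_ord w ord_max).
by rewrite !inE pw desc eqxx.
Qed.

(** * Binomial polynomials: degree, values and integrality *)

Local Open Scope ring_scope.

(* The binomial coefficient C(X - c, k). *)
Definition bin_poly (c k : nat) : {poly rat} :=
  k`!%:R^-1 *: \prod_(i < k) ('X - (c + i)%:R%:P).

Lemma size_bin_poly c k : size (bin_poly c k) = k.+1.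
Proof.
rewrite size_scale ?size_prod_XsubC ?[index_enum _]unlock.
  by rewrite -enumT size_enum_ord.
by rewrite invr_eq0 pnatr_eq0 -lt0n fact_gt0.
Qed.

Lemma bin_poly_nat c k n : (c <= n)%N -> (bin_poly c k).[n%:R] = 'C(n - c, k)%:R.
Proof.
move=> cn; have fk : k`!%:R != 0 :> rat by rewrite pnatr_eq0 -lt0n fact_gt0.
apply: (mulfI fk); rewrite hornerZ mulVKf // -natrM mulnC bin_ffact horner_prod.
elim: k {fk} => [|k IH]; first by rewrite big_ord0 ffactn0.
rewrite big_ord_recr /= IH ffactnSr natrM !hornerE.
(* If [n - c < k], the falling factorial vanishes on both sides; otherwise the subtractions in [nat]
   are exact. *)
have [lt|le] := ltnP (n - c) k; first by rewrite ffact_small // !mul0r.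
by rewrite natrB // natrB // natrD; congr (_ * _); ring.
Qed.

(** Induction on [k], then on [z] in both directions from 0, where the product vanishes: by [step],
    the difference of consecutive values is [k.+1] times a product of [k] factors. *)
Lemma fact_dvd_falling k (z : int) :
  exists y : int, \prod_(i < k) (z - i%:Z) = k`!%:Z * y.
Proof.
elim: k z => [|k IH] z; first by exists 1; rewrite big_ord0 mulr1.
have step (x : int) : \prod_(i < k.+1) (x + 1 - i%:Z) =
    \prod_(i < k.+1) (x - i%:Z) + k.+1%:Z * \prod_(i < k) (x - i%:Z).
  rewrite big_ord_recl big_ord_recr /= (eq_bigr (fun i : 'I_k => x - i%:Z)); last first.
    by move=> i _; rewrite /bump /=; lia.
  rewrite -[k.+1]addn1 PoszD; ring.
elim/int_rec: z => [|m [y IHm]|m [y IHm]].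
- by exists 0; rewrite big_ord_recl subr0 mul0r mulr0.
- have [y' IHy] := IH m; exists (y + y').
  rewrite (_ : m.+1%:Z = m%:Z + 1); last lia.
  rewrite step IHm IHy factS PoszM; ring.
- have [y' IHy] := IH (- m.+1%:Z); exists (y - y').
  have := step (- m.+1%:Z); rewrite (_ : - m.+1%:Z + 1 = - m%:Z); last lia.
  rewrite IHm IHy factS PoszM => /eqP; rewrite -subr_eq => /eqP <-; ring.
Qed.

Lemma bin_poly_int c k (z : int) : (bin_poly c k).[z%:~R] \is a Num.int.
Proof.
have [y Hy] := fact_dvd_falling k (z - c%:Z).
have fk : k`!%:R != 0 :> rat by rewrite pnatr_eq0 -lt0n fact_gt0.
rewrite hornerZ horner_prod (_ : \prod_(i < k) _ = (k`!%:Z * y)%:~R).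
  by rewrite rmorphM /= -pmulrn mulKf // intr_int.
rewrite -Hy rmorph_prod; apply: eq_bigr => i _.
by rewrite !hornerE /= !rmorphB /= natrD; ring.
Qed.

(* [l] stands for t_k - 1 in the formula of the header. *)
Definition ascent_poly (k l : nat) : {poly rat} :=
  bin_poly 0 k - (if k == 0%N then 0 else bin_poly (k - l) l).

(** Complementary counting: from all sets of size [k], remove those containing the [k - l] largest
    elements. *)
Lemma card_ascent n k l : (k <= n)%N -> (0 < k -> l < k)%N ->
  #|[set A : {set 'I_n} | (#|A| == k) &&
      ((k == 0) || ~~ ([set x : 'I_n | n - (k - l) <= x] \subset A))%N]|%:R
  = (ascent_poly k l).[n%:R] :> rat.
Proof.
move=> kn lk; rewrite /ascent_poly hornerD hornerN bin_poly_nat // subn0.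
have card_k : #|[set A : {set 'I_n} | #|A| == k]| = 'C(n, k) by rewrite card_draws card_ord.
case: posnP => k0.
  rewrite hornerC subr0 -card_k; congr _%:R; apply: eq_card => A.
  by rewrite !inE k0 andbT.
rewrite bin_poly_nat; last lia.
have -> : 'C(n - (k - l), l) = 'C(n - (k - l), k - (k - l)).
  by congr 'C(_, _); have := lk k0; lia.
rewrite -card_superset //; last by lia.
apply/eqP; rewrite eq_sym subr_eq -natrD eqr_nat -card_k.
rewrite -(cardsID [set A : {set 'I_n} | [set x : 'I_n | (n - (k - l) <= x)%N] \subset A]).
rewrite addnC; apply/eqP; congr (_ + _)%N; apply: eq_card => A; rewrite !inE //.
by rewrite andbC.
Qed.

(** The terms [bin_poly 0 k] add up to a positive multiple of one polynomial of degree [k], and the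
    subtracted terms have smaller degree. *)
Lemma size_ascent_sum k (I : finType) (P : pred I) (l : I -> nat) :
    (exists i, P i) -> (forall i, 0 < k -> l i < k)%N ->
  size (\sum_(i | P i) ascent_poly k (l i)) = k.+1.
Proof.
move=> [i0 Pi0] lk; rewrite sumrB sumr_const -scaler_nat.
have sz : size (#|P|%:R *: bin_poly 0 k) = k.+1.
  by rewrite size_scale ?size_bin_poly // pnatr_eq0 -lt0n; apply/card_gt0P; exists i0.
rewrite size_polyDl sz // size_polyN ltnS.
apply: leq_trans (size_sum _ _ _) _; apply/bigmax_leqP => i _.
by case: posnP => k0; rewrite ?size_poly0 // size_bin_poly lk.
Qed.

Local Close Scope ring_scope.

(** * Counting the peak class through head patterns *)

Section PeakClass.
Variables (S : {fset nat}) (k : nat).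
(** Together, these hypotheses make [k.+1] the maximum of [S] if [k > 0], and force [S] to be empty
    if [k = 0]. *)
Hypothesis S_gt1 : forall i, i \in S -> 1 < i.
Hypothesis S_le : forall i, i \in S -> i <= k.+1.
Hypothesis S_max : 0 < k -> k.+1 \in S.

Let descending_end n (w : 'S_n.+1) := (peaks w == S) && (entry w n.+1 < entry w n).

Lemma descending_end_decreasing n (w : 'S_n.+1) : k < n ->
  descending_end w -> decreasing_from k w.
Proof.
move=> kn /andP[/eqP pw desc]; apply: peaks_descent_decreasing => //; by rewrite pw.
Qed.

(** Peaks below [k] are those of [t], and the decreasing tail has none beyond [k.+1]. For [k > 0],
    an ascent from [k] to [k.+1] makes [k.+1] a peak and prevents [k] from being one. *)
Lemma descending_end_shuffle n (t : 'S_k) (A : {set 'I_n.+1}) : k < n -> #|A| = k ->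
  descending_end (shuffle t A) =
  (peaks t == (S `\ k.+1)%fset) &&
  ((k == 0) || ~~ ([set x : 'I_n.+1 | n.+1 - (k - (entry t k).-1) <= x] \subset A)).
Proof.
move=> kn Ak; set w := shuffle t A.
have dw : decreasing_from k w by exact: shuffle_decreasing.
have dw' := elimT (decreasing_from_entry k w) dw.
have pt i : (i \in peaks t) = (i < k) && (i \in peaks w).
  by apply: (@peaks_head _ _ _ _ A) => //; [lia | move=> a b ab; exact: shuffle_head].
have -> : (k == 0) || ~~ ([set x : 'I_n.+1 | n.+1 - (k - (entry t k).-1) <= x] \subset A)
    = (k == 0) || (entry w k < entry w k.+1).
  case: posnP => //= k0.
  have lk : k.-1 < k by rewrite prednK.
  have la : k.-1 < n.+1 by lia.
  have lb : k < n.+1 by lia.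
  have := entry_ord t (Ordinal lk); rewrite /= prednK // => ->.
  have := entry_ord w (Ordinal la); rewrite /= prednK // => ->.
  rewrite (entry_ord w (Ordinal lb)) ltnS /=; apply/esym.
  by apply: shuffle_ascent => //=; rewrite prednK.
apply/andP/andP => [[/eqP pw desc]|[/eqP ptS asc]].
  have kp : 0 < k -> entry w k < entry w k.+1.
    by move/S_max; rewrite -pw in_peaks => /and4P[].
  split; last by case: posnP => //= /kp.
  apply/eqP/fsetP => i; rewrite pt pw !inE.
  have [iS|//] := boolP (i \in S); last by rewrite !andbF.
  rewrite !andbT; have ik1 := S_le iS; have i1 := S_gt1 iS.
  (* Were [k] in [S], it would be a peak, against the ascent [kp]. *)
  have [ik|ik] := eqVneq i k; last by lia.
  move: (iS); rewrite -pw in_peaks ik => /and4P[_ _ _].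
  by have := kp ltac:(lia); lia.
have kp : 0 < k -> entry w k < entry w k.+1.
  by move=> k0; case/orP: asc => // /eqP k0'; rewrite k0' in k0.
split; last by apply: dw'; lia.
apply/eqP/fsetP => i.
have [ik|ki|ik] := ltngtP i k.
- have := pt i; rewrite ptS in_fsetD1 ik /= => <-.
  by rewrite (_ : i != k.+1) //; lia.
- have [e|ne] := eqVneq i k.+1.
    rewrite e in_peaks; have [k0|k0] := posnP k.
      rewrite k0 /=; apply/esym/negP => /S_gt1; lia.
    by rewrite S_max // (kp k0) dw' //; lia.
  have lt : k.+1 < i by lia.
  apply/idP/idP => [/(peaks_decreasing dw)|/S_le]; lia.
- rewrite ik; have := pt k; rewrite ptS in_fsetD1 ltnn /= => /negbT kS.
  rewrite in_peaks; have [k0|k0] := posnP k.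
    by rewrite k0 /=; apply/esym/negP => /S_gt1.
  have /negbTE -> : k \notin S by apply: contra kS => ->; lia.
  have := kp k0; lia.
Qed.

Lemma card_descending_end n : k < n ->
  (#|peak_class_desc S n.+1|%:R =
   (\sum_(t : 'S_k | peaks t == (S `\ k.+1)%fset)
      ascent_poly k (entry t k).-1).[n.+1%:R] :> rat)%R.
Proof.
move=> kn; rewrite peak_class_descE.
rewrite (_ : [set w | _] = [set w | decreasing_from k w && descending_end w]); last first.
  apply/setP => w; rewrite !inE; apply/esym/andb_idl; exact: descending_end_decreasing.
rewrite card_decreasing_from; last by lia.
rewrite natr_sum horner_sum [RHS]big_mkcond; apply: eq_bigr => t _.
case: ifP => pt.
  rewrite -card_ascent; [|lia|by move=> k0; apply: entry_pred_lt; rewrite k0 leqnn].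
  congr (_%:R)%R; apply: eq_card => A; rewrite !inE; apply: andb_id2l => /eqP Ak.
  by rewrite descending_end_shuffle // pt.
(* A pattern with the wrong peaks contributes no permutation. *)
apply/eqP; rewrite pnatr_eq0 cards_eq0; apply/eqP/setP => A; rewrite !inE.
by apply/negP => /andP[/eqP Ak]; rewrite descending_end_shuffle // pt.
Qed.

(** The head of any permutation with peak set [S] serves, since [k] and [k.+1] are never both peaks.
    This keeps the final sum nonempty, hence of degree [k]. *)
Lemma exists_peaks_pattern n : admissible S n ->
  exists t : 'S_k, peaks t == (S `\ k.+1)%fset.
Proof.
case=> _ /set0Pn[w]; rewrite inE => /eqP pw.
have [k0|k0] := posnP k.
  exists 1%g; apply/eqP/fsetP => i; rewrite in_peaks !inE.
  have [iS|_] := boolP (i \in S); first by have := S_le iS; have := S_gt1 iS; lia.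
  by rewrite andbF; apply/negbTE; rewrite !negb_and; lia.
have kw : k.+1 \in peaks w by rewrite pw S_max.
case: n w pw kw => [|n] w pw kw; first by move: kw; rewrite in_peaks ltn0 !andbF.
have kn : k <= n.+1 by move: kw; rewrite in_peaks => /and4P[_]; lia.
have [t [A [Ak wt]]] := head_pattern w kn.
exists t; apply/eqP/fsetP => i; rewrite (peaks_head _ kn Ak wt) pw !inE.
have [iS|_] := boolP (i \in S); last by rewrite !andbF.
rewrite !andbT; have ik1 := S_le iS.
have [ik|] := eqVneq i k; last by lia.
move: iS kw; rewrite -pw ik !in_peaks /= => /and4P[_ _ _ d] /and4P[_ _ a _]; lia.
Qed.

End PeakClass.

Lemma bigmax_mem (s : seq nat) : \max_(i <- s) i = 0 \/ \max_(i <- s) i \in s.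
Proof.
elim: s => [|x s IH]; first by left; rewrite big_nil.
rewrite big_cons; case: (leqP x (\max_(i <- s) i)) => [le|lt].
  by case: IH => [->|IH]; [left | right; rewrite inE IH orbT].
by right; rewrite mem_head.
Qed.

Theorem theorem11 (S : {fset nat})
    (S_pos : forall i : nat, i \in S -> 0 < i)
    (S_adm : exists n : nat, admissible S n) :
  exists p : {poly rat},
    [/\ size p = (max_or_one S - 1).+1,
        forall z : int, (p.[z%:~R])%R \is a Num.int
      & forall n : nat, 2 <= n -> sub_interval S (n - 1) -> admissible S n ->
          (#|peak_class_desc S n|%:R = p.[n%:R])%R].
Proof.
have [n0 adm] := S_adm.
have S_gt1 i : i \in S -> 1 < i.
  by case: adm => _ /set0Pn[w]; rewrite inE => /eqP <-; rewrite in_peaks => /andP[].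
set k := max_or_one S - 1.
have S_le i : i \in S -> i <= k.+1.
  move=> iS; rewrite /k /max_or_one; case: eqVneq => [S0|_].
    by rewrite S0 inE in iS.
  have : i <= \max_(j <- S) j by exact: (leq_bigmax_seq (F := id) i).
  lia.
have S_max : 0 < k -> k.+1 \in S.
  rewrite /k /max_or_one; case: eqVneq => // _ k0; rewrite -addn1 subnK; last by lia.
  by case: (bigmax_mem S) k0 => [->|].
exists (\sum_(t : 'S_k | peaks t == (S `\ k.+1)%fset) ascent_poly k (entry t k).-1)%R.
split=> [|z|[//|n] n2 Sn _].
- apply: size_ascent_sum; first exact: exists_peaks_pattern adm.
  by move=> t k0; apply: entry_pred_lt; rewrite k0 leqnn.
- rewrite horner_sum rpred_sum // => t _; rewrite hornerD hornerN rpredB ?bin_poly_int //.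
  by case: ifP; rewrite ?horner0 ?rpred0 ?bin_poly_int.
- apply: card_descending_end => //.
  (* The bound [k < n] comes from [k.+1] being in [S], or from [2 <= n.+1] when [k = 0]. *)
  by have [k0|/S_max/Sn] := posnP k; lia.
Qed.
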